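(* Let $K$ be a field, let $S$ be a positively graded $K$-algebra, let $w>0$ be a real number, and let $0\rightarrow U \rightarrow M \rightarrow N \rightarrow 0$ be a graded short exact sequence (with degree-preserving maps) of finitely generated $\mathbb N$-graded $S$-modules. Then $$\zeta_{M}(z,w) = \zeta_U(z,w) + \zeta_N(z,w).$$
   Context: A positively graded $K$-algebra is a finitely generated graded $K$-algebra $S=\bigoplus_{n\ge0}S_n$ with $S_0=K$. For a finitely generated graded $S$-module $M=\bigoplus_{n\ge0}M_n$ put $H(M,n)=\dim_K M_n$ and, for real $w>0$, $\zeta_M(z,w)=\sum_{n\ge 0}\frac{H(M,n)}{(n+w)^z}$. The series converges absolutely for $\operatorname{Re} z>\dim M$ and is understood elsewhere by its meromorphic continuation to $\mathbb C$. *)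

(* Defs.v *)
From HB Require Import structures.
From mathcomp Require Import all_boot all_order all_algebra.
From mathcomp Require Import complex.
From mathcomp Require Import all_classical all_reals all_analysis.

Set Implicit Arguments.
Unset Strict Implicit.
Unset Printing Implicit Defensive.

Import Order.TTheory GRing.Theory Num.Theory.
Import numFieldNormedType.Exports.

Local Open Scope classical_set_scope.
Local Open Scope ring_scope.

(** ** Graded algebras and modules (internal gradings) *)

Definition internal_direct_sum (V : zmodType) (G : nat -> set V) : Prop :=
  [/\ forall n, G n 0 /\ (forall x y, G n x -> G n y -> G n (x - y)),
      forall x, exists (N : nat) (y : nat -> V),
        (forall n, G n (y n)) /\ x = \sum_(n < N) y n
    & forall (N : nat) (y : nat -> V), (forall n, G n (y n)) ->
        \sum_(n < N) y n = 0 -> forall n, (n < N)%N -> y n = 0].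

Definition fg_algebra (K : fieldType) (S : comAlgType K) : Prop :=
  exists s : seq S, forall A : {pred S},
    GRing.subalg_closed A -> {subset s <= A} -> forall x, x \in A.

Record positively_graded (K : fieldType) (S : comAlgType K)
    (GS : nat -> set S) : Prop := PositivelyGraded {
  pgr_sum : internal_direct_sum GS;
  pgr_mul : forall i j a b, GS i a -> GS j b -> GS (i + j)%N (a * b);
  pgr_deg0 : GS 0%N = range (fun k : K => k%:A : S);
  pgr_fg : fg_algebra S
}.

Definition fg_module (S : nzRingType) (M : lmodType S) : Prop :=
  exists (r : nat) (g : 'I_r -> M),
    forall x, exists c : 'I_r -> S, x = \sum_(i < r) c i *: g i.

Record fg_graded_module (K : fieldType) (S : comAlgType K) (GS : nat -> set S)
    (M : lmodType S) (GM : nat -> set M) : Prop := FgGradedModule {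
  gmod_sum : internal_direct_sum GM;
  gmod_scale : forall i j a x, GS i a -> GM j x -> GM (i + j)%N (a *: x);
  gmod_fg : fg_module M
}.

Record graded_ses (S : nzRingType) (U M N : lmodType S) (GU : nat -> set U)
    (GM : nat -> set M) (GN : nat -> set N)
    (f : {linear U -> M}) (g : {linear M -> N}) : Prop := GradedSES {
  ses_degl : forall n u, GU n u -> GM n (f u);
  ses_degr : forall n m, GM n m -> GN n (g m);
  ses_inj : injective f;
  ses_exact : forall m, g m = 0 <-> exists u, f u = m;
  ses_surj : forall n, exists m, g m = n
}.

(** ** Hilbert function *)

(* [K] acts on the [S]-module [M] through the structure map [k |-> k%:A]. *)
Definition is_Kbasis (K : fieldType) (S : comAlgType K) (M : lmodType S)
    (V : set M) (d : nat) (b : 'I_d -> M) : Prop :=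
  (forall i, V (b i)) /\
  (forall x, V x -> exists! c : 'rV[K]_d, x = \sum_(i < d) (c 0 i)%:A *: b i).

(* [V] is meant to be a [K]-subspace; the value is 0 if it has no finite
   basis. *)
Definition Kdim (K : fieldType) (S : comAlgType K) (M : lmodType S)
    (V : set M) : nat :=
  xget 0%N [set d | exists b : 'I_d -> M, is_Kbasis V b].

Definition hilbert (K : fieldType) (S : comAlgType K) (M : lmodType S)
    (GM : nat -> set M) (n : nat) : nat := Kdim (GM n).

(** ** Meromorphic functions on the complex plane *)

(* [R[i]] seen as a [numClosedFieldType], so that the canonical topology of
   numeric fields is found. *)
Definition cplx (R : realType) : numClosedFieldType := R[i].

Definition analytic_at (R : realType) (f : cplx R -> cplx R) (c : cplx R)
    : Prop :=
  exists a : nat -> cplx R, \forall z \near c,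
    series (fun n => a n * (z - c) ^+ n) @ \oo --> f z.

Definition pole_at (R : realType) (f : cplx R -> cplx R) (c : cplx R) : Prop :=
  exists (m : nat) (h : cplx R -> cplx R),
    [/\ (0 < m)%N, analytic_at h c, h c != 0
      & \forall z \near c^', f z = h z / (z - c) ^+ m].

(* Meromorphic on the whole plane, with removable singularities removed; the
   value of [f] at a pole is irrelevant. *)
Definition meromorphic (R : realType) (f : cplx R -> cplx R) : Prop :=
  forall c, analytic_at f c \/ pole_at f c.

(** ** The zeta function of a graded module *)

(* x ^ z = exp (z * ln x), for x > 0 *)
Definition rcpow (R : realType) (x : R) (z : cplx R) : cplx R :=
  let t := ln x in
  Complex (expR (complex.Re z * t) * cos (complex.Im z * t))
          (expR (complex.Re z * t) * sin (complex.Im z * t)).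

Definition zeta_term (R : realType) (H : nat -> nat) (w : R) (z : cplx R)
    (n : nat) : cplx R :=
  (H n)%:R / rcpow (n%:R + w) z.

(* [f] is the meromorphic continuation to the plane of the Dirichlet series
   with coefficients [hilbert GM n].  Convergence is not assumed: [f] has to be
   the sum of the series at every point where the latter converges absolutely.
   For a finitely generated graded module over a positively graded algebra this
   set contains the half-plane Re z > dim M, so [f] is determined, except for
   its values at its poles. *)
Definition is_zeta (R : realType) (K : fieldType) (S : comAlgType K)
    (M : lmodType S) (GM : nat -> set M) (w : R) (f : cplx R -> cplx R)
    : Prop :=
  meromorphic f /\
  forall z : cplx R,
    cvgn (series (fun n => `|zeta_term (hilbert GM) w z n|)) ->
    series (zeta_term (hilbert GM) w z) @ \oo --> f z.

(* Main.v *)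
(** Exactness in each degree makes the Hilbert functions additive, so the
    identity holds termwise wherever all three series converge absolutely.
    Monomials in homogeneous generators bound the Hilbert functions
    polynomially, so this happens on a half-plane.  It propagates to the plane
    by the identity theorem: the zeros of a meromorphic function are isolated
    unless it vanishes on a punctured neighbourhood, so the set of points with
    the latter property is open and closed, and lines in the plane are
    connected. *)

Require Import Defs.
From HB Require Import structures.
From mathcomp Require Import all_boot all_order all_algebra.
From mathcomp Require Import complex ring lra.
From mathcomp Require Import all_classical all_reals all_analysis.

Set Implicit Arguments.
Unset Strict Implicit.
Unset Printing Implicit Defensive.

Import Order.TTheory GRing.Theory Num.Theory.
Import numFieldNormedType.Exports.

Local Open Scope classical_set_scope.
Local Open Scope ring_scope.

(** * Dimensions and Hilbert functions *)

Section Dimension.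
Variables (K : fieldType) (S : comAlgType K) (M : lmodType S).
Implicit Types (k l : K) (x y : M) (V P : set M).

Lemma in_algZ k l x : (k * l)%:A *: x = k%:A *: (l%:A *: x).
Proof. by rewrite scalerA -scalerAl mul1r scalerA. Qed.

Lemma in_algD k l x : (k + l)%:A *: x = k%:A *: x + l%:A *: x.
Proof. by rewrite !scalerDl. Qed.

Definition Kcomb d (b : 'I_d -> M) (c : 'rV[K]_d) : M :=
  \sum_(i < d) (c 0 i)%:A *: b i.

Lemma Kcomb0 d (b : 'I_d -> M) : Kcomb b 0 = 0.
Proof. by apply: big1 => i _; rewrite mxE !scale0r. Qed.

Lemma Kcomb_linear d (b : 'I_d -> M) k c c' :
  Kcomb b (k *: c + c') = k%:A *: Kcomb b c + Kcomb b c'.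
Proof.
rewrite /Kcomb scaler_sumr -big_split; apply: eq_bigr => i _ /=.
by rewrite !mxE in_algD in_algZ.
Qed.

Lemma KcombB d (b : 'I_d -> M) c c' : Kcomb b (c - c') = Kcomb b c - Kcomb b c'.
Proof.
have -> : c - c' = -1 *: c' + c by rewrite scaleN1r addrC.
by rewrite Kcomb_linear !scaleN1r addrC.
Qed.

Lemma Kcomb_delta d (b : 'I_d -> M) i : Kcomb b (delta_mx 0 i) = b i.
Proof.
rewrite /Kcomb (bigD1 i) //= big1 => [|j ji].
  by rewrite mxE !eqxx !scale1r addr0.
by rewrite mxE eqxx (negbTE ji) !scale0r.
Qed.

Lemma Kcomb_mulmx d e (b : 'I_e -> M) (c : 'rV[K]_d) (A : 'M[K]_(d, e)) :
  Kcomb b (c *m A) = Kcomb (fun i => Kcomb b (row i A)) c.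
Proof.
rewrite /Kcomb; under [RHS]eq_bigr do rewrite scaler_sumr.
rewrite exchange_big; apply: eq_bigr => j _ /=.
rewrite mxE !scaler_suml; apply: eq_bigr => i _.
by rewrite mxE in_algZ.
Qed.

Lemma Kcomb_row_mx d e (b : 'I_(d + e) -> M) c c' :
  Kcomb b (row_mx c c') =
  Kcomb (b \o lshift e) c + Kcomb (b \o @rshift d e) c'.
Proof.
rewrite /Kcomb big_split_ord; congr (_ + _); apply: eq_bigr => i _.
  by rewrite row_mxEl.
by rewrite row_mxEr.
Qed.

Lemma Kcomb_lift d (b : 'I_d.+1 -> M) i (c : 'rV[K]_d.+1) : c 0 i = 0 ->
  Kcomb b c = Kcomb (b \o lift i) (col' i c).
Proof.
move=> ci0; rewrite /Kcomb (bigD1_ord i) //= ci0 !scale0r add0r.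
by apply: eq_bigr => j _; rewrite mxE.
Qed.

Lemma Kbasis_intro V d (b : 'I_d -> M) :
  (forall i, V (b i)) -> (forall x, V x -> exists c, x = Kcomb b c) ->
  (forall c, Kcomb b c = 0 -> c = 0) -> is_Kbasis V b.
Proof.
move=> Vb span free; split=> // x Vx.
have [c ->] := span x Vx; exists c; split=> // c' /esym eq_cc'.
by apply/esym/subr0_eq/free; rewrite KcombB [Kcomb b c']eq_cc' subrr.
Qed.

(** Coordinates are unique only for elements of [V], which need not be a subspace, so membership is
    a hypothesis. *)
Lemma Kbasis_inj V d (b : 'I_d -> M) (c c' : 'rV[K]_d) : is_Kbasis V b ->
  V (Kcomb b c) -> Kcomb b c = Kcomb b c' -> c = c'.
Proof.
move=> [_ bP] Vc eq_cc'; have [e [_ uniq]] := bP _ Vc.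
by rewrite -(uniq c erefl); apply: uniq.
Qed.

Lemma Kbasis_free V d (b : 'I_d -> M) (c : 'rV[K]_d) : V 0 ->
  is_Kbasis V b -> Kcomb b c = 0 -> c = 0.
Proof.
by move=> V0 bV c0; apply: (Kbasis_inj bV); rewrite c0 ?Kcomb0.
Qed.

(** The matrices expressing each family in the other multiply to the identity of size [d], which
    thus factors through size [d']. *)
Lemma Kbasis_leq V d d' (b : 'I_d -> M) (b' : 'I_d' -> M) :
  is_Kbasis V b -> is_Kbasis V b' -> (d <= d')%N.
Proof.
move=> bV b'V; have [[Vb bP] [Vb' b'P]] := (bV, b'V).
have /choice[A bA] i : exists c, b i = Kcomb b' c.
  by have [c []] := b'P _ (Vb i); exists c.
have /choice[B b'B] i : exists c, b' i = Kcomb b c.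
  by have [c []] := bP _ (Vb' i); exists c.
apply: (@mulmx1_min K _ _ (\matrix_i A i) (\matrix_i B i)).
apply/row_matrixP => i; rewrite row_mul rowK row1.
have eq_b : Kcomb b (A i *m \matrix_j B j) = b i.
  rewrite Kcomb_mulmx [RHS]bA; apply: eq_bigr => j _.
  by rewrite rowK -b'B.
apply: (Kbasis_inj bV); first by rewrite eq_b.
by rewrite eq_b Kcomb_delta.
Qed.

Lemma KdimE V d (b : 'I_d -> M) : is_Kbasis V b -> Kdim V = d.
Proof.
move=> bV; apply: xget_unique; first by exists b.
move=> d' [b' b'V]; apply/eqP.
by rewrite eqn_leq (Kbasis_leq b'V bV) (Kbasis_leq bV b'V).
Qed.

Lemma Kbasis_exists V r (v : 'I_r -> M) :
  (forall i, V (v i)) -> (forall x, V x -> exists c, x = Kcomb v c) ->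
  exists2 d, (d <= r)%N & exists b : 'I_d -> M, is_Kbasis V b.
Proof.
elim: r v => [|r IH] v Vv span.
  exists 0%N => //; exists v; apply: Kbasis_intro => // c _.
  by apply/rowP => -[].
have [free|] := pselect (forall c, Kcomb v c = 0 -> c = 0).
  by exists r.+1 => //; exists v; apply: Kbasis_intro.
move=> /existsNP[c] /not_implyP[vc0] /eqP/rV0Pn[i ci0].
have [] := IH (v \o lift i).
- by move=> j; apply: Vv.
- move=> x /span[e ->].
  (* Subtracting a multiple of the relation [c] makes the coefficient at [i] zero. *)
  have -> : Kcomb v e = Kcomb v (- (e 0 i / c 0 i) *: c + e).
    by rewrite Kcomb_linear vc0 scaler0 add0r.
  eexists; apply: Kcomb_lift.
  by rewrite !mxE mulNr divfK // addNr.
by move=> d dr bP; exists d => //; apply: leqW.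
Qed.

(* Inductive, rather than by explicit finite combinations, so that closure
   properties are proved by structural induction. *)
Inductive Kspan P : M -> Prop :=
| Kspan0 : Kspan P 0
| KspanZD k v x : P v -> Kspan P x -> Kspan P (k%:A *: v + x).

Lemma Kspan_gen P x : P x -> Kspan P x.
Proof.
move=> Px; have -> : x = 1%:A *: x + 0 by rewrite !scale1r addr0.
by apply: KspanZD => //; apply: Kspan0.
Qed.

Lemma KspanD P x y : Kspan P x -> Kspan P y -> Kspan P (x + y).
Proof.
move=> Px Py; elim: Px => [|k v z Pv _ IH]; first by rewrite add0r.
by rewrite -addrA; apply: KspanZD.
Qed.

Lemma KspanZ P k x : Kspan P x -> Kspan P (k%:A *: x).
Proof.
elim=> [|l v z Pv _ IH]; first by rewrite scaler0; apply: Kspan0.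
by rewrite scalerDr -in_algZ; apply: KspanZD.
Qed.

Lemma Kspan_sum P (I : Type) (r : seq I) (F : I -> M) :
  (forall i, Kspan P (F i)) -> Kspan P (\sum_(i <- r) F i).
Proof.
move=> PF; elim/big_rec: _ => [|i x _ Px]; first exact: Kspan0.
exact: KspanD.
Qed.

Lemma sub_Kspan P V x :
  V 0 -> (forall k u v, V u -> V v -> V (k%:A *: u + v)) -> P `<=` V ->
  Kspan P x -> V x.
Proof. by move=> V0 VZD PV; elim=> // k v y /PV Vv _; apply: VZD. Qed.

(** The alternative [y = 0] serves for products of the wrong formal degree, which lie in a given
    graded piece only when they vanish. *)
Lemma Kspan_Kcomb (I : finType) (v : I -> M) P x :
  (forall y, P y -> y = 0 \/ exists i, y = v i) -> Kspan P x ->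
  exists c : 'rV_#|I|, x = Kcomb (v \o enum_val) c.
Proof.
move=> Pv; elim=> [|k y z /Pv yP _ [c ->]].
  by exists 0; rewrite Kcomb0.
case: yP => [->|[i ->]]; first by exists c; rewrite scaler0 add0r.
exists (k *: delta_mx 0 (enum_rank i) + c).
by rewrite Kcomb_linear Kcomb_delta /= enum_rankK.
Qed.

End Dimension.

(** * Homogeneous components *)

Section DirectSum.
Variables (V : zmodType) (G : nat -> set V).
Hypothesis GV : internal_direct_sum G.

Lemma ids0 n : G n 0.
Proof. by case: GV => /(_ n)[]. Qed.

Lemma idsB n x y : G n x -> G n y -> G n (x - y).
Proof. by case: GV => /(_ n)[_ GB] _ _; apply: GB. Qed.

Lemma idsD n x y : G n x -> G n y -> G n (x + y).
Proof.
move=> Gx Gy; rewrite -[y]opprK -[- y]sub0r; apply: idsB => //.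
by apply: idsB => //; apply: ids0.
Qed.

Lemma ids_if n (b : bool) x : G n x -> G n (if b then x else 0).
Proof. by case: b => // _; apply: ids0. Qed.

Lemma sum_if_ltn N N' (y : nat -> V) : (N <= N')%N ->
  \sum_(i < N) y i = \sum_(i < N') if (i < N)%N then y i else 0.
Proof. by move=> le_NN'; rewrite (big_ord_widen _ y le_NN') big_mkcond. Qed.

Lemma sum_if_eq n N (x : nat -> V) : (n < N)%N ->
  \sum_(i < N) (if i == n :> nat then x i else 0) = x n.
Proof.
by move=> lt_nN; rewrite -big_mkcond (big_pred1 (Ordinal lt_nN)).
Qed.

(** The difference of the two decompositions of [x] is a relation, so its terms vanish by
    directness. *)
Lemma ids_component n N (y : nat -> V) x : G n x ->
  (forall i, G i (y i)) -> x = \sum_(i < N) y i ->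
  x = if (n < N)%N then y n else 0.
Proof.
move=> Gx Gy xy; case: GV => _ _ uniq.
pose z i := (if (i < N)%N then y i else 0) - (if i == n then x else 0).
(* This length covers both the given sum and the index [n], even when [N <= n]. *)
have /(_ (N + n.+1)%N z) := uniq.
have Gz i : G i (z i).
  apply: idsB; first exact: ids_if.
  by case: eqP => [->|_] //; apply: ids0.
have z0 : \sum_(i < N + n.+1) z i = 0.
  rewrite sumrB -sum_if_ltn ?leq_addr // -xy.
  by rewrite (sum_if_eq (fun=> x)) ?subrr // addnS ltnS leq_addl.
move=> /(_ Gz z0 n); rewrite addnS ltnS leq_addl => /(_ isT)/eqP.
by rewrite /z eqxx subr_eq0 => /eqP.
Qed.

(** Padding by zeros keeps a decomposition valid at every larger length, so that finitely many
    elements can share one length. *)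
Lemma ids_decomp x : exists N (y : nat -> V), (forall n, G n (y n)) /\
  forall N', (N <= N')%N -> x = \sum_(n < N') y n.
Proof.
case: GV => _ /(_ x)[N [y [Gy xy]]] _.
exists N, (fun n => if (n < N)%N then y n else 0); split=> [n|N' NN'].
  exact: ids_if.
by rewrite -sum_if_ltn.
Qed.

End DirectSum.

(** * Polynomial growth and additivity of Hilbert functions *)

Section Growth.
Variables (K : fieldType) (S : comAlgType K) (GS : nat -> set S).
Hypothesis hS : positively_graded GS.

Section Module.
Variables (M : lmodType S) (GM : nat -> set M).
Hypothesis hM : fg_graded_module GS GM.

Lemma graded_ZD n (k : K) (u v : M) : GM n u -> GM n v -> GM n (k%:A *: u + v).
Proof.
move=> Gu Gv; apply: (idsD (gmod_sum hM)) => //.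
by apply: (gmod_scale hM (i := 0)) => //; rewrite (pgr_deg0 hS); exists k.
Qed.

(** Grouping the terms of a combination by degree gives the components of [x]; having degree [n],
    [x] equals its component there. *)
Lemma Kspan_homogeneous (P : set M) n x :
  (forall v, P v -> exists e, GM e v) -> Kspan P x -> GM n x ->
  Kspan (P `&` GM n) x.
Proof.
move=> homP Px Gx; have GMsum := gmod_sum hM.
have [N [y [Py xy]]] : exists N (y : nat -> M),
    (forall i, Kspan (P `&` GM i) (y i)) /\ x = \sum_(i < N) y i.
  elim: Px => [|k v z Pv _ [N [y [Py zy]]]].
    by exists 0%N, (fun=> 0); split=> [i|]; rewrite ?big_ord0 //; apply: Kspan0.
  have [e Gv] := homP v Pv.
  exists (N + e.+1)%N, (fun i => (if i == e then k%:A *: v else 0) +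
                              (if (i < N)%N then y i else 0)).
  split=> [i|].
    apply: KspanD; last by case: ifP => // _; apply: Kspan0.
    case: eqP => [->|_]; last exact: Kspan0.
    by apply/KspanZ/Kspan_gen.
  rewrite big_split /= -sum_if_ltn ?leq_addr // -zy.
  by rewrite (sum_if_eq (fun=> k%:A *: v)) // addnS ltnS leq_addl.
have Gy i : GM i (y i).
  apply: sub_Kspan (Py i); [exact: ids0|exact: graded_ZD|exact: subIsetr].
rewrite (ids_component GMsum Gx Gy xy).
by case: ifP => // _; apply: Kspan0.
Qed.

End Module.

(** Bilinearity of the action, by one induction on each span. With [M := S^o] it also handles
    products in the algebra. *)
Lemma Kspan_scale (M : lmodType S) (P : set S^o) (Q R : set M) a x :
  (forall a x, P a -> Q x -> R (a *: x)) ->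
  Kspan P a -> Kspan Q x -> Kspan R (a *: x).
Proof.
move=> PQR Pa Qx; elim: Pa => [|k b c Pb _ IH].
  by rewrite scale0r; apply: Kspan0.
rewrite scalerDl; apply: KspanD => //; rewrite -scalerA; apply: KspanZ.
elim: Qx => [|l v z Qv _ IHz]; first by rewrite scaler0; apply: Kspan0.
rewrite scalerDr scalerA mulrC -scalerA; apply: KspanZD => //.
exact: PQR.
Qed.

Definition monomial (I : finType) (X : I -> S) (al : I -> nat) : S^o :=
  \prod_i X i ^+ al i.

Lemma homogeneous_prod (I : Type) (r : seq I) (F : I -> S) (d : I -> nat) :
  (forall i, GS (d i) (F i)) -> GS (\sum_(i <- r) d i)%N (\prod_(i <- r) F i).
Proof.
move=> GF; elim: r => [|i r IH].
  by rewrite !big_nil (pgr_deg0 hS); exists 1 => //; rewrite scale1r.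
by rewrite !big_cons; apply: (pgr_mul hS).
Qed.

Lemma homogeneous_monomial (I : finType) (X : I -> S) (d al : I -> nat) :
  (forall i, GS (d i) (X i)) -> GS (\sum_i al i * d i)%N (monomial X al).
Proof.
move=> GX; apply: homogeneous_prod => i.
elim: (al i) => [|n IH].
  by rewrite expr0 mul0n (pgr_deg0 hS); exists 1 => //; rewrite scale1r.
by rewrite exprS mulSn; apply: (pgr_mul hS).
Qed.

(** The homogeneous components of positive degree of the algebra generators suffice, since those of
    degree 0 are scalars: the span of their monomials is a subalgebra containing all generators. *)
Lemma homogeneous_generators : exists (I : finType) (X : I -> S) (d : I -> nat),
  [/\ forall i, GS (d i) (X i), forall i, (0 < d i)%N
    & forall x : S^o, Kspan (range (monomial X)) x].
Proof.
have [s sP] := pgr_fg hS.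
have [yy yyP] := choice (fun x => ids_decomp (pgr_sum hS) x).
have [y yP] := choice yyP.
pose N := \max_(j < size s) yy (nth 0%R s j).
pose I : finType := ('I_(size s) * 'I_N)%type.
pose X (i : I) := y (nth 0%R s i.1) i.2.+1.
exists I, X, (fun i : I => i.2.+1); split=> //.
  by move=> i; have [] := yP (nth 0%R s i.1).
set P := range (monomial X).
have P1 : P 1.
  by exists (fun=> 0%N) => //; rewrite /monomial big1.
pose A : {pred S} := [pred x : S | `[< Kspan (M := S^o) P x >]].
suff AT x : x \in A by move=> x; have /asboolP := AT x.
apply: sP.
  split=> [|k u v|u v].
  - by apply/asboolP/Kspan_gen.
  - move=> /asboolP Pu /asboolP Pv; apply/asboolP/KspanD => //.
    have -> : k *: u = k%:A *: (u : S^o) by rewrite -[RHS]scalerAl mul1r.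
    exact: KspanZ.
  move=> /asboolP Pu /asboolP Pv; apply/asboolP.
  apply: (Kspan_scale (M := S^o)) Pu Pv => _ _ [al _ <-] [be _ <-].
  exists (fun i => al i + be i)%N => //.
  by rewrite /monomial; under eq_bigr do rewrite exprD; rewrite big_split.
move=> _ /(nthP 0)[j js <-]; apply/asboolP.
(* Length [N.+1] separates degree 0, a multiple of the empty monomial, from degrees 1 to [N], whose
   components are variables. *)
have [Gy sE] := yP (nth 0%R s j); rewrite (sE N.+1); last first.
  apply: leqW.
  exact: (@leq_bigmax _ (fun j : 'I__ => yy (nth 0%R s j)) (Ordinal js)).
rewrite big_ord_recl; apply: KspanD.
  have := Gy 0%N; rewrite (pgr_deg0 hS) => -[k _ <-].
  rewrite -[k%:A]mulr1; apply: (KspanZ (M := S^o)).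
  exact: Kspan_gen.
apply: Kspan_sum => i; apply: Kspan_gen.
exists (fun i' => (i' == (Ordinal js, i)) : nat) => //.
rewrite /monomial (bigD1 (Ordinal js, i)) //= eqxx expr1 big1 ?mulr1 // => i'.
by move=> /negbTE ->; rewrite expr0.
Qed.

(** Monomials times homogeneous module generators span the module. As all variables have positive
    degree, exponents in degree [n] are at most [n], which leaves [n.+1 ^ #|I|] monomials per
    generator. *)
Lemma Kbasis_poly_growth (M : lmodType S) (GM : nat -> set M) :
  fg_graded_module GS GM -> exists p q, forall n,
    exists2 d, (d <= q * n.+1 ^ p)%N & exists b : 'I_d -> M, is_Kbasis (GM n) b.
Proof.
move=> hM; have [I [X [d [GX d_gt0 XS]]]] := homogeneous_generators.
have [r [g gP]] := gmod_fg hM.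
have GMsum := gmod_sum hM.
have [yy yyP] := choice (fun x => ids_decomp GMsum x).
have [y yP] := choice yyP.
pose N := \max_(j < r) yy (g j).
pose J : finType := ('I_r * 'I_N)%type.
pose Y (j : J) := y (g j.1) j.2.
have GY (j : J) : GM j.2 (Y j) by have [] := yP (g j.1).
pose P : set M := fun x => exists (al : I -> nat) (j : J), x = monomial X al *: Y j.
have GP al (j : J) :
    GM (\sum_i al i * d i + j.2)%N (monomial X al *: Y j).
  by apply: (gmod_scale hM) => //; apply: homogeneous_monomial.
have spanP x : Kspan P x.
  have [c ->] := gP x; apply: Kspan_sum => i.
  apply: (Kspan_scale (Q := range Y)) (XS (c i)) _.
    by move=> _ _ [al _ <-] [j _ <-]; exists al, j.
  have [_ gE] := yP (g i); rewrite (gE N); last first.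
    exact: (@leq_bigmax _ (fun j : 'I__ => yy (g j))).
  by apply: Kspan_sum => j; apply: Kspan_gen; exists (i, j).
exists #|I|, #|{: J}| => n.
pose T : finType := ({ffun I -> 'I_n.+1} * J)%type.
(* Products outside degree [n] are replaced by 0, so that the whole family lies in [GM n]. *)
pose v (t : T) : M := let x := monomial X (fun i => t.1 i) *: Y t.2 in
  if `[< GM n x >] then x else 0.
have [||e le_e eb] := @Kbasis_exists K S M (GM n) #|{: T}| (v \o enum_val).
- move=> i; rewrite /v /=; case: asboolP => // _; exact: ids0.
- move=> x Gx; apply: (Kspan_Kcomb (P := P `&` GM n)).
    move=> z [[al [j ->]] Gz].
    have [eq_n|ne_n] := eqVneq n (\sum_i al i * d i + j.2)%N; last first.
      (* An element homogeneous of two different degrees is zero. *)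
      left; have := ids_component GMsum (N := (\sum_i al i * d i + j.2).+1)
        (y := fun i => if i == (\sum_i al i * d i + j.2)%N
                       then monomial X al *: Y j else 0) Gz.
      rewrite (sum_if_eq (fun=> monomial X al *: Y j)) // (negbTE ne_n).
      rewrite if_same; apply=> // i.
      by case: eqP => [->|_] //; apply: ids0.
    have le_n i : (al i < n.+1)%N.
      rewrite ltnS eq_n; apply: leq_trans (leq_addr _ _).
      rewrite (bigD1 i) //=; apply: leq_trans (leq_addr _ _).
      by rewrite leq_pmulr.
    right; exists ([ffun i => Ordinal (le_n i)], j); rewrite /v /=.
    have -> : monomial X (fun i => [ffun i => Ordinal (le_n i)] i) =
              monomial X al by apply: eq_bigr => i _; rewrite ffunE.
    by rewrite asboolT.
  apply: Kspan_homogeneous Gx => // _ [al [j ->]].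
  by exists (\sum_i al i * d i + j.2)%N.
exists e => //; apply: leq_trans le_e _.
by rewrite card_prod card_ffun card_ord mulnC.
Qed.

Lemma hilbert_poly_growth (M : lmodType S) (GM : nat -> set M) :
  fg_graded_module GS GM ->
  exists p q, forall n, (hilbert GM n <= q * n.+1 ^ p)%N.
Proof.
move=> /Kbasis_poly_growth[p [q pqP]]; exists p, q => n.
have [d le_d [b bP]] := pqP n.
by rewrite /hilbert (KdimE bP).
Qed.

(** The images of a basis of the degree [n] part of [U], together with homogeneous lifts of a basis
    of that of [N], form a basis of that of [M]. *)
Lemma hilbert_ses (U M N : lmodType S) (GU : nat -> set U) (GM : nat -> set M)
    (GN : nat -> set N) (f : {linear U -> M}) (g : {linear M -> N}) :
  fg_graded_module GS GU -> fg_graded_module GS GM -> fg_graded_module GS GN ->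
  graded_ses GU GM GN f g ->
  forall n, hilbert GM n = (hilbert GU n + hilbert GN n)%N.
Proof.
move=> hU hM hN hfg n.

have [? [? /(_ n)[dU _ [bU bUP]]]] := Kbasis_poly_growth hU.
have [? [? /(_ n)[dN _ [bN bNP]]]] := Kbasis_poly_growth hN.
have [[GUs GMs] GNs] := (gmod_sum hU, gmod_sum hM, gmod_sum hN).
(* Both maps respect degrees, so the degree [n] component of a preimage of a degree [n] element is
   again a preimage. *)
have fK u : GM n (f u) -> exists2 u', GU n u' & f u' = f u.
  move=> Gfu; have [_ /(_ u)[k [y [Gy uy]]] _] := GUs.
  exists (if (n < k)%N then y n else 0); first exact: ids_if.
  rewrite (fun_if f) linear0.
  apply/esym; apply: (ids_component GMs Gfu (y := f \o y)).
    by move=> i; apply: (ses_degl hfg).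
  by rewrite uy linear_sum.
have gK x : GN n x -> exists2 m, GM n m & g m = x.
  move=> Gx; have [m mx] := ses_surj hfg x.
  have [_ /(_ m)[k [y [Gy my]]] _] := GMs.
  exists (if (n < k)%N then y n else 0); first exact: ids_if.
  rewrite (fun_if g) linear0.
  apply/esym; apply: (ids_component GNs Gx (y := g \o y)).
    by move=> i; apply: (ses_degr hfg).
  by rewrite -mx my linear_sum.
have [bUG bUs] := bUP; have [bNG bNs] := bNP.
have /choice[l lP] i : exists m, GM n m /\ g m = bN i.
  by have [m] := gK _ (bNG i); exists m.
pose b (i : 'I_(dU + dN)) :=
  match fintype.split i with inl j => f (bU j) | inr j => l j end.
have bE cU cN : Kcomb b (row_mx cU cN) = f (Kcomb bU cU) + Kcomb l cN.
  rewrite Kcomb_row_mx; congr (_ + _).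
    rewrite /Kcomb linear_sum; apply: eq_bigr => i _ /=.
    by rewrite linearZ /b -[lshift _ _]/(unsplit (inl _)) unsplitK.
  apply: eq_bigr => i _ /=.
  by rewrite /b -[rshift _ _]/(unsplit (inr _)) unsplitK.
have glE c : g (Kcomb l c) = Kcomb bN c.
  by rewrite /Kcomb linear_sum; apply: eq_bigr => i _; rewrite linearZ (lP i).2.
have gf u : g (f u) = 0 by apply/(ses_exact hfg); exists u.
rewrite /hilbert (KdimE bUP) (KdimE bNP); apply: (KdimE (b := b)).
apply: Kbasis_intro => [i|x Gx|c].
- rewrite /b; case: fintype.split => j; last by have [] := lP j.
  by apply: (ses_degl hfg).
- have [cN [gx _]] := bNs _ (ses_degr hfg Gx).
  (* What remains after subtracting the lifted combination is in the kernel of [g], hence comes from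
     [U]. *)
  have /(ses_exact hfg)[u fu] : g (x - Kcomb l cN) = 0.
    by rewrite linearB /= glE gx subrr.
  have Glc : GM n (Kcomb l cN).
    rewrite /Kcomb; elim/big_rec: _ => [|i z _ Gz]; first exact: ids0.
    by apply: (graded_ZD hM) => //; have [] := lP i.
  have [|u' Gu' fu'] := fK u; first by rewrite fu; apply: idsB.
  have [cU [u'E _]] := bUs _ Gu'.
  exists (row_mx cU cN); rewrite bE -[Kcomb bU cU]u'E fu' fu.
  by rewrite subrK.
rewrite -[c]hsubmxK bE => c0.
(* Applying [g] kills the part from [U], which isolates the coefficients [cN]; injectivity of [f]
   then treats the others. *)
have /(Kbasis_free (ids0 GNs n) bNP) cN0 : Kcomb bN (rsubmx c) = 0.
  by rewrite -glE -[LHS]add0r -(gf (Kcomb bU (lsubmx c))) -linearD c0 linear0.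
move: c0; rewrite cN0 Kcomb0 addr0 -[RHS](linear0 f) => /(ses_inj hfg).
by move=> /(Kbasis_free (ids0 GUs n) bUP) ->; rewrite row_mx0.
Qed.

End Growth.

(** * Identity theorem for meromorphic functions *)

Section PowerSeries.
Variable F : numFieldType.
Implicit Types (a : nat -> F) (c z q r B : F).

(** The subtracted term makes the induction work: [q ^+ t <= 2 * q ^+ t - 2 * q ^+ t.+1] when [q] is
    at most one half. *)
Lemma geometric_tail q m k : 0 <= q -> q <= 2^-1 ->
  \sum_(m <= n < m + k) q ^+ n <= 2 * q ^+ m - 2 * q ^+ (m + k).
Proof.
move=> q0 q2; elim: k => [|k IH]; first by rewrite addn0 big_geq // subrr.
rewrite addnS big_nat_recr ?leq_addr //=.
apply: le_trans (lerD IH (lexx _)) _.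
rewrite -addrA lerD2l exprS mulrA; set t := q ^+ (m + k).
have -> : - (2 * t) + t = - t by rewrite mulr_natl mulr2n opprD subrK.
by rewrite lerN2 ler_piMl ?exprn_ge0 // mulrC -ler_pdivlMr // div1r.
Qed.

Lemma power_tail a r B z m k : 0 < r -> (forall n, `|a n| * r ^+ n <= B) ->
  `|z| <= r / 2 ->
  `|\sum_(m <= n < m + k) a n * z ^+ n| <= B * 2 * (`|z| / r) ^+ m.
Proof.
move=> r0 aB zr; have B0 : 0 <= B.
  by apply: le_trans (aB 0%N); rewrite mulr_ge0 ?exprn_ge0 // ltW.
have q0 : 0 <= `|z| / r by rewrite divr_ge0 // ltW.
apply: le_trans (ler_norm_sum _ _ _) _.
apply: (@le_trans _ _ (\sum_(m <= n < m + k) B * (`|z| / r) ^+ n)).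
  apply: ler_sum => n _; rewrite normrM normrX expr_div_n mulrA mulrAC.
  by rewrite ler_wpM2r ?exprn_ge0 // ler_pdivlMr ?exprn_gt0.
rewrite -mulr_sumr -mulrA ler_wpM2l //.
have q2 : `|z| / r <= 2^-1 by rewrite ler_pdivrMr // mulrC.
apply: le_trans (geometric_tail _ _ q0 q2) _.
by rewrite gerBl mulr_ge0 ?exprn_ge0.
Qed.

Lemma power_coef_bound a r : 0 < r ->
  cvgn (series (fun n => a n * r ^+ n)) -> exists B, forall n, `|a n| * r ^+ n <= B.
Proof.
move=> r0 /cvg_series_cvg_0/cvgP/cvg_seq_bounded ub.
have [B _ aB] := ex_strict_bound_gt0 ub; exists B => n.
have /ltW := aB n I; rewrite /= normrM normrX.
by rewrite (gtr0_norm r0).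
Qed.

Lemma series_cvgD (u v : nat -> F) (l l' : F) :
  series u @ \oo --> l -> series v @ \oo --> l' ->
  series (fun n => u n + v n) @ \oo --> l + l'.
Proof.
move=> ul vl; have -> : series (fun n => u n + v n) = series u + series v.
  by apply/funext => n; rewrite fctE /series /= -big_split.
exact: cvgD.
Qed.

Lemma series_cvgM k (u : nat -> F) (l : F) :
  series u @ \oo --> l -> series (fun n => k * u n) @ \oo --> k * l.
Proof.
move=> ul; have -> : series (fun n => k * u n) = (fun n => k * series u n).
  by apply/funext => n; rewrite /series /= mulr_sumr.
exact: cvgMl_tmp.
Qed.

Lemma series_cvg_behead (u : nat -> F) (l : F) : u 0%N = 0 ->
  series (fun n => u n.+1) @ \oo --> l -> series u @ \oo --> l.
Proof.
move=> u0 ul; rewrite -cvg_shiftS.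
rewrite (_ : [sequence (series u) n.+1]_n = series (fun n => u n.+1)) //.
by apply/funext => n; rewrite /series /= big_nat_recl // u0 add0r.
Qed.

End PowerSeries.

(** * Local behaviour of analytic and meromorphic functions *)

Section Analytic.
Variable R : realType.
Notation C := (cplx R).
Implicit Types (f g h : C -> C) (c : C).

Definition has_series (a : nat -> C) c f :=
  \forall z \near c, series (fun n => a n * (z - c) ^+ n) @ \oo --> f z.

(** Convergence at [c + e / 2] bounds the coefficients; on the disc of half that radius the tail is
    dominated by a geometric series of ratio at most one half. *)
Lemma taylor_bound a c f m : has_series a c f ->
  exists2 B : C, 0 <= B & \forall z \near c,
    `|f z - \sum_(n < m) a n * (z - c) ^+ n| <= B * `|z - c| ^+ m.
Proof.
move=> /nbhs_normP[e e0 fP].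
have r0 : 0 < e / 2 :> C by rewrite divr_gt0.
have [|B aB] := @power_coef_bound _ a (e / 2) r0.
  have /fP/cvgP : ball_ Num.norm c e (c + e / 2).
    rewrite /ball_ /= opprD addNKr normrN gtr0_norm //.
    by rewrite ltr_pdivrMr // ltr_pMr // ltr1n.
  by rewrite addrAC subrr add0r.
have B0 : 0 <= B.
  by apply: le_trans (aB 0%N); rewrite mulr_ge0 ?exprn_ge0 // ltW.
exists (B * 2 / (e / 2) ^+ m).
  by rewrite divr_ge0 ?mulr_ge0 ?exprn_ge0 // ltW.
apply/nbhs_normP; exists (e / 2 / 2); first by rewrite /= divr_gt0.
move=> z /= zc; have {}zc : `|z - c| < e / 2 / 2 by rewrite distrC.
have /fP/cvgrPdist_lt fz : ball_ Num.norm c e z.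
  rewrite /ball_ /= distrC; apply: lt_trans zc _.
  by rewrite -mulrA gtr_pMr // -invfM invf_lt1 // -natrM ltr1n.
(* The tail bound holds for all partial sums beyond [m] and passes to the limit up to an arbitrary
   [d]. *)
apply/ler_addgt0Pl => d d0; have [N _ /= fN] := fz _ d0.
have := fN (m + N)%N (leq_addl _ _) => {fN}.
rewrite /series /= (big_cat_nat (leq0n m) (leq_addr N m)) /= big_mkord opprD addrA.
set u := _ - \sum_(_ < _) _ => /ltW ud.
rewrite -[u](subrK (\sum_(m <= i < m + N) a i * (z - c) ^+ i)).
apply: le_trans (ler_normD _ _) (lerD ud _).
rewrite mulrAC -mulrA -expr_div_n.
exact: power_tail (ltW zc).
Qed.

Lemma near_dnbhs c (P : C -> Prop) :
  (\forall z \near c, P z) -> \forall z \near c^', P z.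
Proof. exact: nbhs_dnbhs. Qed.

(* Isolated zeros: the first nonzero coefficient dominates near the centre. *)
Lemma analytic_dichotomy c f : analytic_at f c ->
  (\forall z \near c, f z = 0) \/ (\forall z \near c^', f z != 0).
Proof.
move=> [a fa].
have [a0|/existsNP ex] := pselect (forall n, a n = 0).
  left; apply: filterS fa => z fz.
  apply: (cvg_unique (@norm_hausdorff _ _) fz).
  rewrite (_ : series _ = fun=> 0); first exact: cvg_cst.
  apply/funext => n; rewrite /series /= big1 // => i _.
  by rewrite a0 mul0r.
right; have {}ex : exists n, a n != 0 by case: ex => n /eqP; exists n.
case: (ex_minnP ex) => m am0 min_m.
have [B B0 fB] := taylor_bound m.+1 fa.
(* This radius forces [B * |z - c|] below the norm of [a m]; the added 1 covers [B = 0]. *)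
have am : 0 < `|a m| / (B + 1) by rewrite divr_gt0 ?normr_gt0 // ltr_wpDl.
have near_am : \forall z \near c, `|z - c| < `|a m| / (B + 1).
  by apply/nbhs_normP; exists (`|a m| / (B + 1)) => //= z; rewrite /= distrC.
near=> z; have zc : z != c by near: z; exact: nbhs_dnbhs_neq.
apply/eqP => fz0.
have : `|f z - \sum_(n < m.+1) a n * (z - c) ^+ n| <= B * `|z - c| ^+ m.+1.
  by near: z; apply: near_dnbhs.
rewrite fz0 sub0r normrN big_ord_recr /= big1 ?add0r => [|i _]; last first.
  apply/eqP; rewrite mulf_eq0; apply/orP; left.
  by apply: contraTT (ltn_ord i); rewrite -leqNgt; apply: min_m.
rewrite normrM normrX exprS mulrA ler_pM2r ?exprn_gt0 ?normr_gt0 ?subr_eq0 //.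
apply/negP; rewrite -real_ltNge ?ger0_real ?mulr_ge0 //.
have : `|z - c| < `|a m| / (B + 1) by near: z; apply: near_dnbhs.
rewrite ltr_pdivlMr ?ltr_wpDl // mulrDr mulr1 mulrC => /le_lt_trans; apply.
by rewrite lerDl.
Unshelve. all: by end_near. Qed.

(** A form of continuity at [c]: punctured neighbourhoods are nonempty, which rules out the other
    case of the dichotomy. *)
Lemma analytic_punctured0 c f : analytic_at f c ->
  (\forall z \near c^', f z = 0) -> f c = 0.
Proof.
move=> /analytic_dichotomy[/nbhs_singleton //|fn0] f0.
have [z [fz /eqP]] := filter_ex (filterI f0 fn0).
by rewrite fz.
Qed.

Lemma eq_analytic c f g : f =1 g -> analytic_at f c -> analytic_at g c.
Proof. by move=> /funext ->. Qed.

Lemma analyticD c f g : analytic_at f c -> analytic_at g c ->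
  analytic_at (fun z => f z + g z) c.
Proof.
move=> [a fa] [b gb]; exists (fun n => a n + b n).
apply: filterS2 fa gb => z fz gz.
rewrite (_ : (fun n => (a n + b n) * (z - c) ^+ n) =
  fun n => a n * (z - c) ^+ n + b n * (z - c) ^+ n).
  exact: series_cvgD fz gz.
by apply/funext => n; rewrite mulrDl.
Qed.

Lemma analyticZ c k f : analytic_at f c -> analytic_at (fun z => k * f z) c.
Proof.
move=> [a fa]; exists (fun n => k * a n); apply: filterS fa => z fz.
rewrite (_ : (fun n => k * a n * (z - c) ^+ n) =
  fun n => k * (a n * (z - c) ^+ n)); first exact: series_cvgM fz.
by apply/funext => n; rewrite mulrA.
Qed.

Lemma analyticB c f g : analytic_at f c -> analytic_at g c ->
  analytic_at (fun z => f z - g z) c.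
Proof.
move=> fc gc; apply: eq_analytic (analyticD fc (analyticZ (-1) gc)) => z.
by rewrite mulN1r.
Qed.

Lemma analyticMX c f m : analytic_at f c ->
  analytic_at (fun z => f z * (z - c) ^+ m) c.
Proof.
elim: m => [|m IH] in f *.
  by apply: eq_analytic => z; rewrite mulr1.
move=> [a fa].
have /IH : analytic_at (fun z => f z * (z - c)) c.
  exists (fun n => if n is n'.+1 then a n' else 0); apply: filterS fa => z fz.
  apply: series_cvg_behead; first by rewrite mul0r.
  rewrite (_ : (fun n => a n * (z - c) ^+ n.+1) =
    fun n => (z - c) * (a n * (z - c) ^+ n)).
    by rewrite mulrC; apply: series_cvgM fz.
  by apply/funext => n; rewrite exprS mulrCA.
by apply: eq_analytic => z; rewrite exprS mulrA.
Qed.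

(** Unlike in [pole_at], [m] may be 0 and [h] may vanish at [c], which makes the notion stable under
    differences. *)
Definition mero_at f c := exists (m : nat) h, analytic_at h c /\
  \forall z \near c^', f z = h z / (z - c) ^+ m.

Lemma meromorphic_mero_at f c : meromorphic f -> mero_at f c.
Proof.
move=> /(_ c)[fc|[m [h [_ hc _ fh]]]]; last by exists m, h.
by exists 0%N, f; split=> //; near=> z; rewrite expr0 divr1.
Unshelve. all: by end_near. Qed.

Lemma mero_atB f g c : mero_at f c -> mero_at g c ->
  mero_at (fun z => f z - g z) c.
Proof.
move=> [m [h [hc fh]]] [m' [h' [hc' gh']]].
exists (m + m')%N, (fun z => h z * (z - c) ^+ m' - h' z * (z - c) ^+ m).
split; first by apply: analyticB; apply: analyticMX.
near=> z; have zc : z - c != 0.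
  by rewrite subr_eq0; near: z; exact: nbhs_dnbhs_neq.
have -> : f z = h z / (z - c) ^+ m by near: z.
have -> : g z = h' z / (z - c) ^+ m' by near: z.
by rewrite exprD; field; rewrite !expf_neq0.
Unshelve. all: by end_near. Qed.

Lemma mero_dichotomy c f : mero_at f c ->
  (\forall z \near c^', f z = 0) \/ (\forall z \near c^', f z != 0).
Proof.
move=> [m [h [/analytic_dichotomy[h0|hn0] fh]]]; [left|right]; near=> z.
  have -> : f z = h z / (z - c) ^+ m by near: z.
  have -> : h z = 0 by near: z; apply: near_dnbhs.
  by rewrite mul0r.
have -> : f z = h z / (z - c) ^+ m by near: z.
rewrite mulf_neq0 //; first by near: z.
by rewrite invr_neq0 // expf_neq0 // subr_eq0; near: z; exact: nbhs_dnbhs_neq.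
Unshelve. all: by end_near. Qed.

(** For [y] other than [c], points close to [y] avoid [c], so puncturing at [c] does no harm
    there. *)
Lemma dnbhs_join c (P : C -> Prop) : (\forall z \near c^', P z) ->
  \forall y \near c, \forall z \near y^', P z.
Proof.
move=> Pc; have /near_join := Pc; apply: filterS => y Py.
have [->//|yc] := eqVneq y c.
have cy : \forall z \near y, z != c.
  apply/nbhs_normP; exists `|y - c|; first by rewrite /= normr_gt0 subr_eq0.
  by move=> z; apply: contraTneq => ->; rewrite ltxx.
near=> z; have : z != c by near: z; apply: near_dnbhs.
by near: z; apply: near_dnbhs.
Unshelve. all: by end_near. Qed.

Lemma normc_real (t : R) : `|t%:C%C : C| = `|t|%:C%C.
Proof. by rewrite normc_def /= expr0n addr0 sqrtr_sqr. Qed.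

Lemma continuous_real_complex : continuous (fun t : R => t%:C%C : C).
Proof.
move=> t; apply/cvgrPdist_lt => e e0.
(* A positive element of the complex field is real. *)
have eE : e = (complex.Re e)%:C%C :> C by rewrite RRe_real ?gtr0_real.
have Re0 : 0 < complex.Re e by rewrite -ltcR -eE.
apply/nbhs_normP; exists (complex.Re e) => // s /= ts.
by rewrite eE -[_%:C%C - _]rmorphB normc_real ltcR.
Qed.

(** [mero_at] leaves the value at the centre free, so the conclusion concerns punctured
    neighbourhoods only. *)
Lemma mero_identity f c0 : (forall c, mero_at f c) ->
  (\forall z \near c0, f z = 0) -> forall c, \forall z \near c^', f z = 0.
Proof.
move=> fm f0 c; pose A := [set c | \forall z \near c^', f z = 0].
have oA : open A by rewrite openE => y; apply: dnbhs_join.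
(* Off [A] the function is nonzero on a punctured neighbourhood, a property that persists at nearby
   points and excludes them from [A]. *)
have cA : closed A.
  rewrite -openC openE => y /= Ay.
  have [//|/dnbhs_join] := mero_dichotomy (fm y).
  apply: filterS => x fx Ax; have [z [fz /eqP]] := filter_ex (filterI Ax fx).
  by rewrite fz.
(* The line through [c0], at [t = 0], and [c], at [t = 1]. *)
pose phi (t : R) : C := c0 + t%:C%C * (c - c0).
have phic : continuous phi.
  move=> t; apply: cvgD; first exact: cvg_cst.
  exact: cvgMr_tmp (@continuous_real_complex t).
have connR : connected [set: R] by apply/connected_intervalP.
suff : phi @^-1` A = setT.
  move=> /seteqP[_ /(_ 1 I)]; rewrite /= /phi.
  by rewrite mul1r addrC subrK.
apply: connR.
- exists 0; rewrite /phi /= mul0r addr0; exact: near_dnbhs.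
- by exists (phi @^-1` A); rewrite ?setTI //; apply: open_comp.
- by exists (phi @^-1` A); rewrite ?setTI //; apply: closed_comp.
Qed.

End Analytic.

(** * Absolute convergence *)

Section Zeta.
Variables (R : realType) (w : R).
Hypothesis w0 : 0 < w.

Lemma norm_rcpow (x : R) (z : cplx R) :
  `|rcpow x z| = (expR (complex.Re z * ln x))%:C%C.
Proof.
rewrite normc_def /= !exprMn -mulrDr cos2Dsin2 mulr1 sqrtr_sqr.
by rewrite ger0_norm ?expR_ge0.
Qed.

Lemma norm_zeta_term H (z : cplx R) n : `|zeta_term H w z n| =
  ((H n)%:R * expR (- (complex.Re z * ln (n%:R + w))))%:C%C.
Proof.
rewrite /zeta_term normrM normr_nat normfV norm_rcpow expRN rmorphM rmorph_nat.
by rewrite fmorphV.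
Qed.

(* Telescoping: [1 / (n+1)^2 <= 2 / ((n+1) (n+2))]. *)
Lemma series_square_bound (u : nat -> R) c : 0 <= c ->
  (forall n, u n.+1 <= c / n.+1%:R ^+ 2) ->
  forall n, \sum_(0 <= i < n.+1) u i <= u 0%N + 2 * c - 2 * c / n.+1%:R.
Proof.
move=> c0 uc; elim=> [|n IH]; first by rewrite big_nat1 divr1 addrK.
rewrite big_nat_recr //=; apply: le_trans (lerD IH (uc n)) _.
have n1 : 0 < n.+1%:R :> R by [].
rewrite -addrA lerD2l.
have -> : n.+2%:R = n.+1%:R + 1 :> R by rewrite [n.+2%:R]mulrSr.
have n1' : 1 <= n.+1%:R :> R by rewrite ler1n.
rewrite -subr_ge0; set t := n.+1%:R in n1 n1' *.
have -> : - (2 * c / (t + 1)) - (- (2 * c / t) + c / t ^+ 2) =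
  c * (t - 1) / ((t + 1) * t ^+ 2).
  by field; rewrite !gt_eqF // addr_gt0.
by rewrite divr_ge0 ?mulr_ge0 ?subr_ge0 ?addr_ge0 ?exprn_ge0 // ltW.
Qed.

(** The power in the denominator beats the growth of [H] by two degrees. Index 0 is left out: the
    logarithm must be nonnegative, and [w] alone may be below 1. *)
Lemma zeta_term_bound H p q (x : R) n : (forall n, (H n <= q * n.+1 ^ p)%N) ->
  p%:R + 2 <= x ->
  (H n.+1)%:R * expR (- (x * ln (n.+1%:R + w))) <=
  (q * 2 ^ p)%:R / n.+1%:R ^+ 2.
Proof.
move=> Hpq px; set t : R := n.+1%:R.
have t0 : 0 < t by [].
have tw : t <= t + w by rewrite lerDl ltW.
have tw0 : 0 < t + w by rewrite addr_gt0.
have expo : expR (- (x * ln (t + w))) <= (t ^+ (p + 2))^-1.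
  rewrite expRN lef_pV2 ?posrE ?expR_gt0 ?exprn_gt0 //.
  apply: (@le_trans _ _ ((t + w) ^+ (p + 2))).
    by rewrite lerXn2r ?nnegrE ?(ltW t0) ?(ltW tw0).
  rewrite -[X in X ^+ _]lnK ?posrE // -expRM_natl ler_expR ler_wpM2r //.
    by rewrite ln_ge0 // (le_trans _ tw) // ler1n.
  by rewrite natrD.
(* The factor [2 ^ p] comes from [n.+2 <= 2 * n.+1]. *)
have Hn : (H n.+1)%:R <= (q * 2 ^ p)%:R * t ^+ p.
  rewrite /t -natrX -natrM ler_nat; apply: leq_trans (Hpq _) _.
  rewrite -mulnA -expnMn leq_mul2l; apply/orP; right.
  by case: (p) => // k; rewrite leq_exp2r // mul2n -addnn addSn addnS !ltnS leq_addr.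
apply: le_trans (ler_pM (ler0n _ _) (expR_ge0 _) Hn expo) _.
by rewrite exprD invfM mulrA mulfK // expf_neq0 // gt_eqF.
Qed.

Lemma zeta_abs_cvg H p q (z : cplx R) : (forall n, (H n <= q * n.+1 ^ p)%N) ->
  p%:R + 2 <= complex.Re z ->
  cvgn (series (fun n => `|zeta_term H w z n|)).
Proof.
move=> Hpq pz.
pose u n : R := (H n)%:R * expR (- (complex.Re z * ln (n%:R + w))).
have u0 n : 0 <= u n by rewrite mulr_ge0 // expR_ge0.
have : cvgn (series u).
  apply: nondecreasing_is_cvgn; first exact: nondecreasing_series.
  exists (u 0%N + 2 * (q * 2 ^ p)%:R) => _ [n _ <-].
  apply: (@le_trans _ _ (series u n.+1)).
    by rewrite seriesSr lerDl.
  apply: le_trans (@series_square_bound u (q * 2 ^ p)%:R _ _ n) _ => //.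
    by move=> {}n; apply: zeta_term_bound.
  by rewrite gerBl divr_ge0 // mulr_ge0.
(* Complex norms are real numbers embedded in [cplx R], so the limit is carried over by continuity
   of the embedding. *)
move=> /cvg_ex[l ul]; apply/cvg_ex; exists (l%:C%C).
have -> : series (fun n => `|zeta_term H w z n|) =
    (fun n => (series u n)%:C%C : cplx R).
  apply/funext => n; rewrite /series /= rmorph_sum; apply: eq_bigr => i _.
  exact: norm_zeta_term.
exact: (cvg_comp _ _ ul (@continuous_real_complex R l)).
Qed.

End Zeta.

(** * Additivity of the zeta functions *)

Theorem proposition1p2 (R : realType) (K : fieldType) (S : comAlgType K)
  (GS : nat -> set S) (hS : positively_graded GS)
  (w : R) (hw : 0 < w)
  (U M N : lmodType S)
  (GU : nat -> set U) (GM : nat -> set M) (GN : nat -> set N)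
  (hU : fg_graded_module GS GU)
  (hM : fg_graded_module GS GM)
  (hN : fg_graded_module GS GN)
  (f : {linear U -> M}) (g : {linear M -> N})
  (hfg : graded_ses GU GM GN f g)
  (zetaU zetaM zetaN : cplx R -> cplx R)
  (hzU : is_zeta GU w zetaU)
  (hzM : is_zeta GM w zetaM)
  (hzN : is_zeta GN w zetaN) :
  (forall c : cplx R, \forall z \near c^', zetaM z = zetaU z + zetaN z) /\
  (forall z : cplx R, analytic_at zetaU z -> analytic_at zetaN z ->
     analytic_at zetaM z /\ zetaM z = zetaU z + zetaN z).
Proof.
have [pU [qU HU]] := hilbert_poly_growth hS hU.
have [pM [qM HM]] := hilbert_poly_growth hS hM.
have [pN [qN HN]] := hilbert_poly_growth hS hN.
have Hadd := hilbert_ses hS hU hM hN hfg.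
have [[mU sU] [mM sM] [mN sN]] := And3 hzU hzM hzN.
(* All three series converge absolutely for real part at least [x0 - 1], a half-plane containing the
   unit disc about [x0]. *)
pose x0 : R := (pU + pM + pN + 3)%:R.
have half z : x0 - 1 <= complex.Re z -> zetaM z = zetaU z + zetaN z.
  move=> xz.
  have abs H p q : (p <= pU + pM + pN)%N ->
      (forall n, (H n <= q * n.+1 ^ p)%N) ->
      cvgn (series (fun n => `|zeta_term H w z n|)).
    move=> le_p Hpq; apply: (zeta_abs_cvg hw Hpq); apply: le_trans xz.
    have -> : x0 - 1 = (pU + pM + pN + 2)%:R by rewrite /x0 addnS -natr1 addrK.
    by rewrite -natrD ler_nat leq_add2r.
  have cU := sU z (abs _ _ _ (leq_trans (leq_addr _ _) (leq_addr _ _)) HU).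
  have cM := sM z (abs _ _ _ (leq_trans (leq_addl _ _) (leq_addr _ _)) HM).
  have cN := sN z (abs _ _ _ (leq_addl _ _) HN).
  apply: (cvg_unique (@norm_hausdorff _ _) cM).
  rewrite (_ : zeta_term (hilbert GM) w z = fun n =>
    zeta_term (hilbert GU) w z n + zeta_term (hilbert GN) w z n).
    exact: series_cvgD cU cN.
  by apply/funext => n; rewrite /zeta_term Hadd natrD mulrDl.
pose D z := zetaM z - zetaU z - zetaN z.
have D0 c : \forall z \near c^', D z = 0.
  move: c; apply: (@mero_identity _ _ (x0%:C%C)).
    move=> c; apply: mero_atB; first apply: mero_atB.
    - exact: meromorphic_mero_at.
    - exact: meromorphic_mero_at.
    - exact: meromorphic_mero_at.
  apply/nbhs_normP; exists 1; first exact: ltr01.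
  move=> z /= /(le_lt_trans (normc_ge_Re _)).
  rewrite -[1]/(1%:C%C) ltcR raddfB /= => /ltr_normlP[_ xz].
  rewrite /D half; last by lra.
  by rewrite [_ + zetaN z]addrC addrK subrr.
have near_eq c : \forall z \near c^', zetaM z = zetaU z + zetaN z.
  apply: filterS (D0 c) => z /eqP.
  by rewrite /D -addrA -opprD subr_eq0 => /eqP.
split; first exact: near_eq.
move=> c aU aN.
have aUN := analyticD aU aN.
(* At a pole of [zetaM], [h] would agree near [c] with the analytic sum times [(z - c) ^+ m], which
   vanishes at [c] as [m] is positive, against [h c != 0]. *)
have aM : analytic_at zetaM c.
  have [//|[m [h [m0 ah /eqP hc0 zh]]]] := mM c; case: hc0.
  have := analytic_punctured0 (analyticB ah (analyticMX m aUN)).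
  rewrite subrr expr0n eqn0Ngt m0 mulr0 subr0; apply.
  near=> z; have zc : z - c != 0.
    by rewrite subr_eq0; near: z; exact: nbhs_dnbhs_neq.
  have <- : zetaM z = zetaU z + zetaN z by near: z; exact: near_eq.
  have -> : zetaM z = h z / (z - c) ^+ m by near: z.
  by rewrite divfK ?subrr // expf_neq0.
split; first exact: aM.
apply/eqP; rewrite -subr_eq0; apply/eqP.
apply: (analytic_punctured0 (analyticB aM aUN)).
by apply: filterS (near_eq c) => z ->; rewrite subrr.
Unshelve. all: by end_near. Qed.
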